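(* Let $\{z_n\}_{n=1}^\infty$ and $\{z'_n\}_{n=1}^\infty$ be weaving frames for the Krein space $(\mathcal K,[\cdot,\cdot])$. For $\sigma\subset\mathbb N$ put $$\sigma_+=\{n\in\sigma:[z_n,z_n]\ge0\},\quad \sigma_-=\{n\in\sigma:[z_n,z_n]<0\},$$ $$\sigma^c_+=\{n\in\sigma^c:[z'_n,z'_n]\ge0\},\quad \sigma^c_-=\{n\in\sigma^c:[z'_n,z'_n]<0\},$$ and let $M_{\sigma_+}=\overline{\mathrm{span}}\big(\{z_n\}_{n\in\sigma_+}\cup\{z'_n\}_{n\in\sigma^c_+}\big)$ and $M_{\sigma_-}=\overline{\mathrm{span}}\big(\{z_n\}_{n\in\sigma_-}\cup\{z'_n\}_{n\in\sigma^c_-}\big)$. Then the following are equivalent: (1) $\{z_n\}_{n=1}^\infty$ and $\{z'_n\}_{n=1}^\infty$ are $J$-weaving frames for $(\mathcal K,[\cdot,\cdot])$. (2) If $M_{\sigma_+}\cap M_{\sigma_+}^\perp=\{0\}$ and $M_{\sigma_-}\cap M_{\sigma_-}^\perp=\{0\}$, then for every $\sigma_\pm\subset\mathbb N$ there exist constants $\beta_-\le\alpha_-<0<\alpha_+\le\beta_+$ such that for every $k\in M_{\sigma_\pm}$, $$\alpha_\pm[k,k]\le\sum_{n\in\sigma_\pm}|[k,z_n]|^2+\sum_{n\in\sigma^c_\pm}|[k,z'_n]|^2\le\beta_\pm[k,k].$$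
   Context: $(\mathcal K,[\cdot,\cdot])$ is a Krein space with fundamental decomposition $\mathcal K=\mathcal K_{\delta^+}\oplus\mathcal K_{\delta^-}$, where $(\mathcal K_{\delta^+},[\cdot,\cdot])$ and $(\mathcal K_{\delta^-},-[\cdot,\cdot])$ are Hilbert spaces that are mutually $[\cdot,\cdot]$-orthogonal. The fundamental symmetry is $J(k_{\delta^+}+k_{\delta^-})=k_{\delta^+}-k_{\delta^-}$. The $J$-inner product $[k,k']_J=[k,Jk']$ makes $\mathcal K$ a Hilbert space, with norm $\|k\|_J^2=[k,Jk]$. Closures are taken in this norm. For a subspace $M$, $M^\perp=\{x\in\mathcal K:[x,y]=0\ \text{for all } y\in M\}$ is the orthogonal companion with respect to the indefinite inner product, so $M\cap M^\perp=\{0\}$ means that $M$ is $J$-non-degenerate. A statement with the subscript $\pm$ is to be read once with all upper signs and once with all lower signs; ''for every $\sigma_\pm\subset\mathbb N$'' ranges over the index sets $\sigma_\pm$ obtained from subsets $\sigma\subset\mathbb N$, with $\sigma^c=\mathbb N\setminus\sigma$. A sequence $\{z_n\}_{n=1}^\infty$ in $\mathcal K$ is a frame for $(\mathcal K,[\cdot,\cdot])$ if there are constants $0<\alpha\le\beta$ such that $\alpha\|k\|_J^2\le\sum_{n=1}^\infty|[k,z_n]|^2\le\beta\|k\|_J^2$ for all $k\in\mathcal K$. Two frames $\{z_n\}$ and $\{z'_n\}$ are weaving frames for $\mathcal K$ if there are universal constants $0<\alpha\le\beta$ such that for all $\sigma\subset\mathbb N$ and all $k\in\mathcal K$, $$\alpha\|k\|_J^2\le\sum_{n\in\sigma}|[k,z_n]|^2+\sum_{n\in\sigma^c}|[k,z'_n]|^2\le\beta\|k\|_J^2.$$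 A subspace $M\subset\mathcal K$ is uniformly $J$-positive (respectively uniformly $J$-negative) if there is $c>0$ with $[x,x]\ge c\|x\|_J^2$ (respectively $-[x,x]\ge c\|x\|_J^2$) for all $x\in M$. It is maximal uniformly $J$-positive (respectively negative) if it is not properly contained in another subspace with the same property. Let $\{w_n\}_{n=1}^\infty$ be a Bessel sequence in $(\mathcal K,[\cdot,\cdot]_J)$ with synthesis operator $T:\ell^2(\mathbb N)\to\mathcal K$, $T\{c_n\}=\sum_n c_nw_n$. Put $I_+=\{n:[w_n,w_n]\ge0\}$ and $I_-=\{n:[w_n,w_n]<0\}$, and let $P^\pm$ be the orthogonal projection of $\ell^2(\mathbb N)$ onto $\ell^2(I_\pm)$. The sequence $\{w_n\}$ is a $J$-frame for $\mathcal K$ if the range $R(TP^+)$ is a maximal uniformly $J$-positive subspace and the range $R(TP^-)$ is a maximal uniformly $J$-negative subspace of $\mathcal K$. Two $J$-frames $\{z_n\}_{n=1}^\infty$ and $\{z'_n\}_{n=1}^\infty$ for $\mathcal K$ are $J$-weaving frames if for every $\sigma\subset\mathbb N$ the family $\{z_n\}_{n\in\sigma}\cup\{z'_n\}_{n\in\sigma^c}$ (that is, $w_n=z_n$ for $n\in\sigma$ and $w_n=z'_n$ for $n\in\sigma^c$) is a $J$-frame for $\mathcal K$.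
   Formalization: Item (2) is read as a conjunction: for every σ, M_{σ+} and M_{σ-} are J-non-degenerate and the constants exist; as a literal ''If ..., then ...'' it holds vacuously for degenerate M_{σ+} (e.g. z=z'=((1,1),(0,1),0,...) in C^2), where (1) fails. *)

(* Defs.v *)
From HB Require Import structures.
From mathcomp Require Import all_boot all_order all_algebra.
From mathcomp Require Import all_classical all_reals all_analysis.
From mathcomp Require Import complex.

Set Implicit Arguments.
Unset Strict Implicit.
Unset Printing Implicit Defensive.

Import Order.TTheory GRing.Theory Num.Theory.
Import numFieldNormedType.Exports.

Local Open Scope classical_set_scope.
Local Open Scope ring_scope.
Local Open Scope complex_scope.

Definition normc2 (R : realType) (c : R[i]) : R := ComplexField.Normc.normc c ^+ 2.

Section Subspaces.
Context {R : realType} {K : completeNormedModType R[i]}.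

Definition is_subspace (M : set K) : Prop :=
  M 0 /\ forall (a : R[i]) x y, M x -> M y -> M (a *: x + y).

Definition closed_span (A : set K) : set K := closure (smallest is_subspace A).

End Subspaces.

(* The carrier is a Banach space whose norm is required, by [krein_norm], to be
   the J-norm; the library's topology on K is therefore the one in which the
   closures and series of the theory are taken.  Since K is complete, a closed
   subspace on which [x, x] (resp. - [x, x]) is the squared norm is a Hilbert
   space for [., .] (resp. - [., .]).  The form is linear in its first
   argument and conjugate-linear in the second. *)
Record krein_space (R : realType) (K : completeNormedModType R[i]) := KreinSpace {
  kform : {hermitian K for false & (@Num.conj R[i])};
  kpos : set K;
  kneg : set K;
  kpos_subspace : is_subspace kpos;
  kneg_subspace : is_subspace kneg;
  kpos_kneg_decomp : forall x, exists p m, [/\ kpos p, kneg m & x = p + m];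
  kpos_kneg_direct : kpos `&` kneg = [set 0];
  kpos_kneg_ortho : forall p m, kpos p -> kneg m -> kform p m = 0;
  kpos_hilbert : closed kpos /\ forall x, kpos x -> kform x x = `|x| ^+ 2;
  kneg_hilbert : closed kneg /\ forall x, kneg x -> - kform x x = `|x| ^+ 2;
  ksym : K -> K;
  ksymE : forall p m, kpos p -> kneg m -> ksym (p + m) = p - m;
  krein_norm : forall x, `|x| ^+ 2 = kform x (ksym x)
}.

Section Krein.
Context {R : realType} {K : completeNormedModType R[i]}.
Variable S : krein_space K.
Implicit Types (z w : nat -> K) (M : set K) (I sigma : set nat).

Definition jform (x y : K) : R[i] := kform S x (ksym S y).

(* [x, x] and [x, x]_J are real, so nothing is lost by taking real parts. *)
Definition qform (x : K) : R := complex.Re (kform S x x).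
Definition jnorm2 (x : K) : R := complex.Re (jform x x).

Definition ortho_companion M : set K :=
  [set x | forall y, M y -> kform S x y = 0].

Definition J_nondegenerate M : Prop := M `&` ortho_companion M = [set 0].

Definition frame_sum w I (k : K) : \bar R :=
  (\esum_(n in I) (normc2 (kform S k (w n)))%:E)%E.

Definition is_frame w : Prop :=
  exists alpha beta : R, [/\ 0 < alpha, alpha <= beta & forall k,
    ((alpha * jnorm2 k)%:E <= frame_sum w setT k)%E /\
    (frame_sum w setT k <= (beta * jnorm2 k)%:E)%E].

Definition weaving_frames z z' : Prop :=
  [/\ is_frame z, is_frame z' &
   exists alpha beta : R, [/\ 0 < alpha, alpha <= beta & forall sigma k,
    ((alpha * jnorm2 k)%:E
       <= frame_sum z sigma k + frame_sum z' (~` sigma) k)%E /\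
    (frame_sum z sigma k + frame_sum z' (~` sigma) k
       <= (beta * jnorm2 k)%:E)%E]].

Definition uniformly_J_positive M : Prop :=
  is_subspace M /\
  exists2 c : R, 0 < c & forall x, M x -> c * jnorm2 x <= qform x.

Definition uniformly_J_negative M : Prop :=
  is_subspace M /\
  exists2 c : R, 0 < c & forall x, M x -> c * jnorm2 x <= - qform x.

Definition maximal_with (P : set K -> Prop) M : Prop :=
  P M /\ forall N, P N -> M `<=` N -> N = M.

Definition is_bessel w : Prop :=
  exists2 beta : R, 0 < beta & forall k,
    (\esum_(n in setT) (normc2 (jform k (w n)))%:E <= (beta * jnorm2 k)%:E)%E.

Definition ell2 : set (nat -> R[i]) :=
  [set c | (\esum_(n in setT) (normc2 (c n))%:E < +oo)%E].

Definition coord_proj I (c : nat -> R[i]) : nat -> R[i] :=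
  fun n => if n \in I then c n else 0.

(* [lim] is a junk value on divergent series; the series converges whenever w
   is a Bessel sequence and c is square-summable. *)
Definition synthesis w (c : nat -> R[i]) : K :=
  limn (series (fun n => c n *: w n)).

Definition synthesis_range w I : set K :=
  [set synthesis w (coord_proj I c) | c in ell2].

Definition pos_idx w sigma : set nat := [set n | sigma n /\ 0 <= qform (w n)].
Definition neg_idx w sigma : set nat := [set n | sigma n /\ qform (w n) < 0].

Definition is_J_frame w : Prop :=
  [/\ is_bessel w,
      maximal_with uniformly_J_positive (synthesis_range w (pos_idx w setT)) &
      maximal_with uniformly_J_negative (synthesis_range w (neg_idx w setT))].

Definition weave z z' sigma : nat -> K :=
  fun n => if n \in sigma then z n else z' n.

Definition J_weaving_frames z z' : Prop :=
  [/\ is_J_frame z, is_J_frame z' & forall sigma, is_J_frame (weave z z' sigma)].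

Definition M_pos z z' sigma : set K :=
  closed_span (z @` pos_idx z sigma `|` z' @` pos_idx z' (~` sigma)).

Definition M_neg z z' sigma : set K :=
  closed_span (z @` neg_idx z sigma `|` z' @` neg_idx z' (~` sigma)).

End Krein.

(* Main.v *)
Require Import Defs.
From mathcomp Require Import all_boot all_order all_algebra.
From mathcomp Require Import all_classical all_reals all_analysis.
From mathcomp Require Import complex.
From mathcomp Require Import ring lra.

Set Implicit Arguments.
Unset Strict Implicit.
Unset Printing Implicit Defensive.

Import Order.TTheory GRing.Theory Num.Theory.
Import numFieldNormedType.Exports.

Local Open Scope classical_set_scope.
Local Open Scope ring_scope.
Local Open Scope complex_scope.

(** For a subset sigma of the index set, let w be the woven sequence; by the
    weaving hypothesis it is a frame with constants independent of sigma, and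
    every assertion of the theorem for sigma is an assertion about w alone.  So
    the theorem follows from a characterization ([J_frameP]) of the J-frames
    among the frames w.  Write M+ and M- for the closed spans of the w_n with
    [w_n, w_n] >= 0 and < 0, and s+(k), s-(k) for the corresponding parts of
    the sum of the |[k, w_n]|^2.

    Two facts about a frame carry both implications.  First, every vector k is
    a sum of c_n w_n with |c|^2 <= |k|^2 / alpha: the frame operator is
    invertible ([frame_reconstruction]).  Secondly, let N be a subspace
    containing the sums of the c_n w_n over the positive indices, and suppose
    that [x, x] >= c0 |x|^2 on N with c0 > 0 (call this coercive) and
    [x, x] <= 0 for all sums over the negative indices.  In the expansion of a
    vector of N, the sum over the negative indices then lies in N and vanishes,
    so the vector is expanded along the positive indices with the same bound on
    c ([coercive_expansion]).  This plays the role of the open mapping theorem.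

    If w is a J-frame, then [.,.] is coercive on M+ by density
    ([coercive_closed_span]), so M+ is nondegenerate, and the upper estimate of
    s+(k) is the Bessel inequality.  For the lower one, expand k in M+ along the
    positive indices: [k, k] is the pairing of c with the ([k, w_n])_n, which is
    at most |c| s+(k)^(1/2) ([coercive_analysis_ge]).

    Conversely, assume M+ nondegenerate and a [k,k] <= s+(k) <= b [k,k] on it.
    Then [.,.] is a semi-inner product on M+ by the upper estimate, and it is
    definite by nondegeneracy.  Let F x be the sum of the [x, w_n] w_n over the
    positive indices, so that [F x, x] = s+(x) and |F x|^2 <= B s+(x).  From
    0 <= [F x - a x, F x - a x] one gets a s+(x) <= [F x, F x], hence
    |y|^2 <= (B / a) [y, y] for y in the range of F.  The iteration
    r := r - F r / B is contracting for the seminorm of [.,.], so each m in M+ is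
    the [.,.]-limit of some F u_j; by the estimate on the range these converge
    in norm, to m by definiteness, and the estimate passes to all of M+
    ([uniform_definite]).  The same applies to - [.,.] and M-.  Now [.,.] is
    coercive on M+ and nonpositive on M-, so [coercive_expansion] applies
    to M+ and to every uniformly positive N containing M+: it shows that both
    are contained in the range of the positive synthesis operator, which is
    contained in M+.  This is maximality ([span_range]). *)

(** * Norm, limits and subspaces *)

Section RealNorm.
Context {R : realType} {K : completeNormedModType R[i]}.
Implicit Types (x y : K) (u : nat -> K) (A M : set K).

Lemma normc2E (c : R[i]) : normc2 c = complex.Re c ^+ 2 + complex.Im c ^+ 2.
Proof. by case: c => a b; rewrite /normc2 /= sqr_sqrtr// addr_ge0 ?sqr_ge0. Qed.

Lemma normc2_ge0 (c : R[i]) : 0 <= normc2 c.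
Proof. exact: sqr_ge0. Qed.

Lemma normc2_conj (a : R[i]) : normc2 (conjc a) = normc2 a.
Proof. by case: a => a b; rewrite !normc2E /= sqrrN. Qed.

Lemma mulcJ (a : R[i]) : a * conjc a = (normc2 a)%:C.
Proof. by case: a => a b; rewrite normc2E; simpc; congr (_ +i* _); ring. Qed.

(** Cauchy-Schwarz inequalities for sums are replaced throughout by this
    weighted form, which adds up termwise. *)
Lemma Re_normc2 (c d : R[i]) (t : R) : 0 < t ->
  2 * complex.Re (c * d) <= t * normc2 c + t^-1 * normc2 d.
Proof.
move=> t0; case: c => a b; case: d => e f; rewrite !normc2E /=.
have h (p q : R) : 2 * (p * q) <= t * p ^+ 2 + t^-1 * q ^+ 2.
  rewrite -subr_ge0 (_ : _ - _ = t^-1 * (t * p - q) ^+ 2); last by field; lra.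
  by rewrite mulr_ge0 ?sqr_ge0 ?invr_ge0 ?ltW.
have h1 := h a e; have h2 := h (- b) f; rewrite sqrrN in h2.
rewrite !mulrDr; lra.
Qed.

(** The norm of [K] is a nonnegative element of [R[i]]; estimates and limits are
    carried out on its real part. *)
Definition rnorm x : R := complex.Re `|x|.

Lemma rnormE x : `|x| = (rnorm x)%:C.
Proof. by rewrite /rnorm RRe_real // ger0_real. Qed.

Lemma rnorm_ge0 x : 0 <= rnorm x.
Proof. by rewrite -ler0c -rnormE. Qed.

Lemma rnormN x : rnorm (- x) = rnorm x.
Proof. by rewrite /rnorm normrN. Qed.

Lemma rnorm_distC x y : rnorm (x - y) = rnorm (y - x).
Proof. by rewrite -rnormN opprB. Qed.

Lemma rnorm0_eq0 x : rnorm x = 0 -> x = 0.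
Proof. by move=> h; apply/normr0_eq0; rewrite rnormE h. Qed.

Lemma cvg_rnorm u l :
  u @ \oo --> l <-> (fun n => rnorm (u n - l)) @ \oo --> (0 : R).
Proof.
split.
- move=> /cvgrPdist_lt h; apply/cvgrPdist_lt => e e0.
  have := h (e%:C); rewrite ltcR => /(_ e0); apply: filterS => n /=.
  by rewrite rnormE ltcR sub0r normrN ger0_norm ?rnorm_ge0 // rnorm_distC.
- move=> /cvgrPdist_lt h; apply/cvgrPdist_lt => e e0.
  have eE : e = (complex.Re e)%:C by rewrite RRe_real // gtr0_real.
  have := h (complex.Re e); rewrite -ltcR -eE => /(_ e0); apply: filterS => n /=.
  by rewrite rnormE [in X in _ -> X]eE ltcR sub0r normrN ger0_norm ?rnorm_ge0 // rnorm_distC.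
Qed.

Lemma rnorm_cauchy_cvg u :
  (forall e : R, 0 < e -> exists N, forall i j, (N <= i)%N -> (N <= j)%N ->
     rnorm (u i - u j) < e) -> cvgn u.
Proof.
move=> h; apply/cauchy_cvgP/cauchy_exP => e e0.
have eE : e = (complex.Re e)%:C by rewrite RRe_real // gtr0_real.
have := h (complex.Re e); rewrite -ltcR -eE => /(_ e0) [N hN].
exists (u N); exists N => //= n Nn.
by rewrite -ball_normE /= rnormE eE ltcR; apply: hN.
Qed.

Lemma closure_rnorm A x :
  closure A x <-> forall e : R, 0 < e -> exists2 y, A y & rnorm (x - y) < e.
Proof.
split.
- move=> + e e0 => /(_ (ball x e%:C)) [].
    by apply: nbhsx_ballx; rewrite ltcR.
  by move=> y [Ay]; rewrite -ball_normE /= rnormE ltcR => ?; exists y.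
- move=> h B /nbhs_ballP [e /= e0 hB].
  have eE : e = (complex.Re e)%:C by rewrite RRe_real // gtr0_real.
  have := h (complex.Re e); rewrite -ltcR -eE => /(_ e0) [y Ay xy].
  by exists y; split => //; apply: hB; rewrite -ball_normE /= rnormE eE ltcR.
Qed.

Lemma cvg_closed M u l : closed M -> (forall n, M (u n)) -> u @ \oo --> l -> M l.
Proof.
move=> cM Mu ul; apply: (closed_cvg _ cM _ _ ul) => //.
by apply: nearW.
Qed.

Lemma cvg_rnorm_sq u l :
  (fun n => rnorm (u n - l) ^+ 2) @ \oo --> (0 : R) -> u @ \oo --> l.
Proof.
move=> ul; apply/cvg_rnorm/cvgrPdist_lt => e e0.
have e20 : 0 < e ^+ 2 by rewrite exprn_gt0.
have [N _ hN] : \forall n \near \oo, rnorm (u n - l) ^+ 2 < e ^+ 2.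
  by apply: (cvgr_lt (0 : R)).
exists N => // n /hN /=; rewrite sub0r normrN ger0_norm ?rnorm_ge0 //.
by rewrite ltr_sqr // ?nnegrE ?rnorm_ge0 // ltW.
Qed.

Section Subspace.
Variables (M : set K) (sM : is_subspace M).

Lemma subspaceD x y : M x -> M y -> M (x + y).
Proof. by move=> Mx My; rewrite -[x]scale1r; apply: sM.2. Qed.

Lemma subspaceZ (a : R[i]) x : M x -> M (a *: x).
Proof. by move=> Mx; rewrite -[_ *: _]addr0; apply: sM.2 => //; exact: sM.1. Qed.

Lemma subspaceB x y : M x -> M y -> M (x - y).
Proof. by move=> Mx My; rewrite addrC -scaleN1r; apply: sM.2. Qed.

Lemma subspace_sum (r : seq nat) (F : nat -> K) :
  (forall i, M (F i)) -> M (\sum_(i <- r) F i).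
Proof.
move=> MF; elim/big_rec: _ => [|i x _ Mx]; [exact: sM.1|exact: subspaceD].
Qed.

End Subspace.

End RealNorm.

(** * Square-summable sequences *)

Section SquareSummable.
Context {R : realType}.
Implicit Types (c : nat -> R[i]).

Definition sqsum c : R := fine (\esum_(n in setT) (normc2 (c n))%:E)%E.

Lemma sqsumE c : ell2 c -> (\esum_(n in setT) (normc2 (c n))%:E = (sqsum c)%:E)%E.
Proof.
move=> cl; rewrite /sqsum fineK // ge0_fin_numE //.
by apply: esum_ge0 => n _; rewrite lee_fin normc2_ge0.
Qed.

Lemma sqsum_cvg c : ell2 c -> series (fun n => normc2 (c n)) @ \oo --> sqsum c.
Proof.
move=> cl.
suff H : (fun n => (series (fun n => normc2 (c n)) n)%:E) @ \oo --> (sqsum c)%:E.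
  exact: (fine_cvg H).
rewrite -sqsumE // -nneseries_esumT; last by move=> n; rewrite lee_fin normc2_ge0.
rewrite (_ : (fun n => _) = (fun n => \sum_(0 <= i < n) (normc2 (c i))%:E)%E).
  by apply: is_cvg_nneseries => n _ _; rewrite lee_fin normc2_ge0.
by apply/funext => n; rewrite /series /= sumEFin.
Qed.

Lemma sqsum_ge0 c : 0 <= sqsum c.
Proof. by apply: fine_ge0; apply: esum_ge0 => n _; rewrite lee_fin normc2_ge0. Qed.

Lemma partial_le_sqsum c n : ell2 c -> \sum_(0 <= i < n) normc2 (c i) <= sqsum c.
Proof.
move=> cl; rewrite -(cvg_lim _ (sqsum_cvg cl)) //.
apply: nondecreasing_cvgn_le; last by apply/cvg_ex; eexists; exact: sqsum_cvg.
by apply: nondecreasing_series => // i _ _; exact: normc2_ge0.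
Qed.

Lemma ell2_le c (B : R) : (\esum_(n in setT) (normc2 (c n))%:E <= B%:E)%E ->
  ell2 c /\ sqsum c <= B.
Proof.
move=> h; have cl : ell2 c by apply: le_lt_trans h _; rewrite ltry.
by split => //; rewrite -lee_fin -sqsumE.
Qed.

End SquareSummable.

Lemma cvg_le_dist {R : realType} (f d : nat -> R) (a C : R) :
  d @ \oo --> 0 -> (forall n, `|f n - a| <= C * d n) -> f @ \oo --> a.
Proof.
move=> d0 fd; apply/subr_cvg0; apply/norm_cvg0P.
apply: (@squeeze_cvgr _ _ _ _ (fun=> 0) (fun n => C * d n)).
- by apply: nearW => n; rewrite normr_ge0 fd.
- exact: cvg_cst.
- by rewrite -(mulr0 C); apply: cvgMr.
Qed.

(** * Hermitian forms *)

Section Hermitian.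
Context {R : realType} {K : completeNormedModType R[i]}.
Implicit Types (x y : K) (u : nat -> K) (A M : set K) (h : K -> K -> R[i]).

Record hermitian_form h : Prop := HermitianForm {
  herm_linear : forall a x y z, h (a *: x + y) z = a * h x z + h y z;
  herm_conj : forall x y, h x y = conjc (h y x)
}.

(** The bound has constant 1 because the norm is the J-norm: it is shared by
    the J-inner product, by [., .] and by - [., .], to which the theory below is
    applied. *)
Record bounded_hermitian h : Prop := BoundedHermitian {
  bounded_herm_form :> hermitian_form h;
  herm_bounded : forall x y, normc2 (h x y) <= (rnorm x * rnorm y) ^+ 2
}.

Definition quad h x : R := complex.Re (h x x).

Lemma ReD (a b : R[i]) : complex.Re (a + b) = complex.Re a + complex.Re b.
Proof. by case: a; case: b. Qed.

Lemma Re_sum (I : Type) (r : seq I) (P : pred I) (F : I -> R[i]) :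
  complex.Re (\sum_(i <- r | P i) F i) = \sum_(i <- r | P i) complex.Re (F i).
Proof. by elim/big_rec2: _ => // i x y _ <-; rewrite ReD. Qed.

Section Theory.
Variables (h : K -> K -> R[i]) (hh : hermitian_form h).

Lemma hermD x y z : h (x + y) z = h x z + h y z.
Proof. by have := herm_linear hh 1 x y z; rewrite scale1r mul1r. Qed.

Lemma herm0 z : h 0 z = 0.
Proof. by apply: (@addrI _ (h 0 z)); rewrite -hermD !addr0. Qed.

Lemma hermZ a x z : h (a *: x) z = a * h x z.
Proof. by have := herm_linear hh a x 0 z; rewrite !addr0 herm0 addr0. Qed.

Lemma hermN x z : h (- x) z = - h x z.
Proof. by rewrite -scaleN1r hermZ mulN1r. Qed.

Lemma hermB x y z : h (x - y) z = h x z - h y z.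
Proof. by rewrite hermD hermN. Qed.

Lemma herm_sum (r : seq nat) (F : nat -> K) z :
  h (\sum_(i <- r) F i) z = \sum_(i <- r) h (F i) z.
Proof. by elim/big_rec2: _ => [|i x y _ <-]; rewrite ?herm0 // hermD. Qed.

Lemma hermDr x y z : h z (x + y) = h z x + h z y.
Proof. by rewrite !(herm_conj hh z) hermD rmorphD. Qed.

Lemma hermZr a x z : h z (a *: x) = conjc a * h z x.
Proof. by rewrite !(herm_conj hh z) hermZ rmorphM. Qed.

Lemma hermNr x z : h z (- x) = - h z x.
Proof. by rewrite -scaleN1r hermZr rmorphN1 mulN1r. Qed.

Lemma herm_ReC x y : complex.Re (h x y) = complex.Re (h y x).
Proof. by rewrite (herm_conj hh); case: (h y x). Qed.

Lemma quadE x : h x x = (quad h x)%:C.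
Proof.
rewrite /quad; have := herm_conj hh x x; case: (h x x) => a b [] /= hb.
by congr (_ +i* _); lra.
Qed.

Lemma quadDZ (t : R) x y :
  quad h (x + t%:C *: y) = quad h x + 2 * t * complex.Re (h x y) + t ^+ 2 * quad h y.
Proof.
have hC := herm_ReC x y; have hy := quadE y.
rewrite /quad hermD hermZ !hermDr !hermZr hy conjc_real /quad.
move: hC; case: (h x y) => a b; case: (h y x) => e f /=.
rewrite !ReD /= => ->; ring.
Qed.

Lemma quadD x y : quad h (x + y) = quad h x + 2 * complex.Re (h x y) + quad h y.
Proof. by have := quadDZ 1 x y; rewrite scale1r expr1n mul1r mulr1. Qed.

(** The form may be degenerate on [M]: positivity of the quadratic polynomial
    t |-> h(x - t h(x,y) y, x - t h(x,y) y) also covers the case h(y,y) = 0. *)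
Lemma quad_cauchy_schwarz M x y : is_subspace M -> (forall z, M z -> 0 <= quad h z) ->
  M x -> M y -> normc2 (h x y) <= quad h x * quad h y.
Proof.
move=> sM qM Mx My.
have [->|hxy] := eqVneq (normc2 (h x y)) 0; first by rewrite mulr_ge0 ?qM.
set H := normc2 _ in hxy *.
have H0 : 0 < H by rewrite lt_def hxy normc2_ge0.
have qt t : 0 <= quad h x - 2 * t * H + t ^+ 2 * (H * quad h y).
  have := qM (x + (- t)%:C *: (h x y *: y)).
  rewrite quadDZ hermZr (_ : quad h (h x y *: y) = H * quad h y); last first.
    by rewrite {1}/quad hermZ hermZr mulrA mulcJ quadE /= mul0r subr0.
  rewrite [conjc _ * _]mulrC mulcJ /= -/H sqrrN mulrN mulNr; apply.
  by apply: subspaceD => //; do 2!apply: subspaceZ => //.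
have [y0|y0] := eqVneq (quad h y) 0.
  (* As H > 0, this polynomial is affine and decreasing, so it is negative at
     a large t. *)
  have := qt ((quad h x + 1) / H); rewrite y0 !mulr0 addr0.
  rewrite (_ : 2 * _ * H = 2 * (quad h x + 1)); last by field.
  by have := qM _ Mx; lra.
have yp : 0 < quad h y by rewrite lt_def y0 qM.
have := qt (quad h y)^-1.
rewrite (_ : _ + _ = (quad h x * quad h y - H) / quad h y); last by field.
by rewrite pmulr_lge0 ?invr_gt0 // subr_ge0.
Qed.

End Theory.

Section BoundedTheory.
Variables (h : K -> K -> R[i]) (hh : bounded_hermitian h).

Lemma Re_herm_le x y : `|complex.Re (h x y)| <= rnorm x * rnorm y.
Proof.
have xy0 : 0 <= rnorm x * rnorm y by rewrite mulr_ge0 ?rnorm_ge0.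
rewrite -[X in _ <= X]ger0_norm // -ler_sqr ?nnegrE ?normr_ge0 // !real_normK ?num_real //.
apply: le_trans (herm_bounded hh x y); rewrite normc2E.
by rewrite lerDl sqr_ge0.
Qed.

Lemma quad_le x : `|quad h x| <= rnorm x ^+ 2.
Proof. exact: Re_herm_le. Qed.

Lemma cvg_Re_herm u l x : u @ \oo --> l ->
  (fun n => complex.Re (h (u n) x)) @ \oo --> complex.Re (h l x).
Proof.
move=> /cvg_rnorm ul; apply: (cvg_le_dist (C := rnorm x) ul) => n.
rewrite -(subrK l (u n)) (hermD hh) ReD addrK subrK mulrC; exact: Re_herm_le.
Qed.

Lemma cvg_quad u l : u @ \oo --> l -> (fun n => quad h (u n)) @ \oo --> quad h l.
Proof.
move=> ul.
have uE n : quad h (u n) =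
    quad h (u n - l) + 2 * (complex.Re (h (u n) l) - quad h l) + quad h l.
  have := quadD hh (u n - l) l; rewrite subrK (hermB hh) ReD => ->.
  by rewrite /quad; case: (h l l).
rewrite (funext uE).
rewrite -[X in _ --> X]add0r; apply: cvgD; last exact: cvg_cst.
rewrite -[X in _ --> X]addr0; apply: cvgD.
  have ul0 := (cvg_rnorm _ _).1 ul.
  have ul2 : (fun n => rnorm (u n - l) ^+ 2) @ \oo --> (0 : R).
    by rewrite -(mulr0 0); exact: (cvgM ul0 ul0).
  apply: (cvg_le_dist (C := 1) ul2) => n.
  by rewrite subr0 mul1r; exact: quad_le.
rewrite -(mulr0 2); apply: cvgMr.
by apply/subr_cvg0; exact: cvg_Re_herm.
Qed.

End BoundedTheory.
End Hermitian.

#[global] Hint Resolve bounded_herm_form : core.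

(** * Bessel sequences and their frame operators *)

Section Synthesis.
Context {R : realType} {K : completeNormedModType R[i]}.
Implicit Types (x y : K) (u v : nat -> K) (M : set K) (h g : K -> K -> R[i]).

(** The form in which the Cauchy criterion arises from the inequality
    |x - y|^2 <= 2 |m - x|^2 + 2 |m - y|^2 for approximations x, y of m. *)
Lemma cauchy_sq_cvg u (a : nat -> R) : a @ \oo --> (0 : R) ->
  (forall i j, rnorm (u i - u j) ^+ 2 <= a i + a j) -> cvgn u.
Proof.
move=> a0 ua; apply: rnorm_cauchy_cvg => e e0.
have e20 : 0 < e ^+ 2 / 2 by rewrite divr_gt0 // exprn_gt0.
have [N _ hN] : \forall n \near \oo, a n < e ^+ 2 / 2.
  by apply: (cvgr_lt (0 : R)).
exists N => i j iN jN; have := ua i j; have := hN i iN; have := hN j jN => /= hj hi hij.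
by rewrite -ltr_sqr ?nnegrE ?rnorm_ge0 // ?ltW //; lra.
Qed.

Definition bessel_bound h v (B : R) := forall k,
  (\esum_(n in setT) (normc2 (h k (v n)))%:E <= (B * rnorm k ^+ 2)%:E)%E.

Lemma bessel_ell2 h v B k : bessel_bound h v B -> ell2 (fun n => h k (v n)).
Proof. by move=> hB; have [] := ell2_le (hB k). Qed.

Lemma synthesis_unique v c l :
  series (fun n => c n *: v n) @ \oo --> l -> synthesis v c = l.
Proof. by move=> h; exact: cvg_lim h. Qed.

(** [g] is the inner product of [K]; it controls convergence, while the forms [h]
    below supply the coefficients. *)
Variables (g : K -> K -> R[i]) (hg : bounded_hermitian g).
Hypothesis gE : forall x, quad g x = rnorm x ^+ 2.
Variables (v : nat -> K) (B : R) (B0 : 0 < B) (vB : bessel_bound g v B).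

(** With y the sum, |y|^2 is the sum of the c_i <v_i, y>; the weight B in
    [Re_normc2] turns the part in <v_i, y> into at most |y|^2 by the Bessel
    inequality, so that it is absorbed on the left. *)
Lemma bessel_sum_le c m n :
  rnorm (\sum_(m <= i < n) c i *: v i) ^+ 2 <= B * \sum_(m <= i < n) normc2 (c i).
Proof.
set y := \sum_(m <= i < n) _.
have yE : quad g y = \sum_(m <= i < n) complex.Re (c i * g (v i) y).
  by rewrite /quad {1}/y (herm_sum hg) Re_sum; apply: eq_bigr => i _; rewrite (hermZ hg).
have y2 : 2 * quad g y <= \sum_(m <= i < n) (B * normc2 (c i) + B^-1 * normc2 (g (v i) y)).
  by rewrite yE mulr_sumr; apply: ler_sum => i _; exact: Re_normc2.
rewrite big_split /= -!mulr_sumr in y2.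
have : \sum_(m <= i < n) normc2 (g (v i) y) <= B * rnorm y ^+ 2.
  apply: le_trans (ell2_le (vB y)).2.
  apply: le_trans (partial_le_sqsum n (bessel_ell2 y vB)).
  under eq_bigr do rewrite (herm_conj hg) normc2_conj.
  have [mn|nm] := leqP m n; last first.
    by rewrite big_geq ?(ltnW nm) // sumr_ge0 // => i _; exact: normc2_ge0.
  rewrite [leRHS](big_cat_nat (n := m)) //= lerDr.
  by rewrite sumr_ge0 // => i _; exact: normc2_ge0.
rewrite -(ler_pM2l (x := B^-1)) ?invr_gt0 // mulKf ?gt_eqF // => y3.
by rewrite gE in y2; lra.
Qed.

Lemma synthesis_cvg c : ell2 c ->
  series (fun n => c n *: v n) @ \oo --> synthesis v c.
Proof.
move=> cl; pose u := series (fun n => c n *: v n).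
pose tail n := B * (sqsum c - series (fun n => normc2 (c n)) n).
apply: (@cauchy_sq_cvg u tail).
  rewrite -(mulr0 B); apply: cvgMr; rewrite -(subrr (sqsum c)).
  by apply: cvgB; [exact: cvg_cst|exact: sqsum_cvg].
have H i j : (i <= j)%N -> rnorm (u i - u j) ^+ 2 <= tail i + tail j.
  move=> ij; rewrite rnorm_distC sub_series_geq //.
  apply: le_trans (bessel_sum_le c i j) _.
  rewrite -sub_series_geq // -mulrDr ler_pM2l //.
  by have := partial_le_sqsum j cl; rewrite /series /=; lra.
move=> i j; case/orP: (leq_total i j) => ij; first exact: H.
by rewrite rnorm_distC [leRHS]addrC; exact: H.
Qed.

Lemma synthesis_le c : ell2 c -> rnorm (synthesis v c) ^+ 2 <= B * sqsum c.
Proof.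
move=> cl; rewrite -gE; apply: (cvgr_to_le (cvg_quad hg (synthesis_cvg cl))).
apply: nearW => n; rewrite gE; apply: le_trans (bessel_sum_le c 0 n) _.
by rewrite ler_pM2l //; exact: partial_le_sqsum.
Qed.

Lemma synthesis_linear a c d : ell2 c -> ell2 d ->
  synthesis v (fun n => a * c n + d n) = a *: synthesis v c + synthesis v d.
Proof.
move=> cl dl; apply: synthesis_unique.
rewrite (_ : series _ = (fun n => a *: series (fun n => c n *: v n) n +
    series (fun n => d n *: v n) n)).
  by apply: cvgD; [apply: cvgZr|]; exact: synthesis_cvg.
apply/funext => n; rewrite /series /= scaler_sumr -big_split; apply: eq_bigr => i _ /=.
by rewrite scalerDl scalerA.
Qed.

Lemma synthesis_closed M c : is_subspace M -> closed M -> (forall n, M (v n)) ->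
  ell2 c -> M (synthesis v c).
Proof.
move=> sM cM Mv cl; apply: cvg_closed cM _ (synthesis_cvg cl) => n.
by apply: subspace_sum => // i; exact: subspaceZ.
Qed.

Section Analysis.
Variables (h : K -> K -> R[i]) (hh : bounded_hermitian h).
Hypothesis hB : bessel_bound h v B.

Definition analysis x := fun n => h x (v n).
Definition frame_op x := synthesis v (analysis x).

Lemma analysis_ell2 x : ell2 (analysis x).
Proof. exact: bessel_ell2 hB. Qed.

Lemma frame_op_linear a x y : frame_op (a *: x + y) = a *: frame_op x + frame_op y.
Proof.
rewrite -synthesis_linear; try exact: analysis_ell2.
by congr synthesis; apply/funext => n; rewrite /analysis (herm_linear hh).
Qed.

Lemma frame_op0 : frame_op 0 = 0.
Proof.
have := frame_op_linear (-1) 0 0; rewrite !scaleN1r oppr0 addr0 => h0.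
by rewrite h0 addNr.
Qed.

Lemma frame_opB x y : frame_op (x - y) = frame_op x - frame_op y.
Proof. by have := frame_op_linear (-1) y x; rewrite !scaleN1r addrC [RHS]addrC. Qed.

Lemma frame_opZ a x : frame_op (a *: x) = a *: frame_op x.
Proof. by have := frame_op_linear a x 0; rewrite frame_op0 !addr0. Qed.

Lemma Re_frame_op x : complex.Re (h (frame_op x) x) = sqsum (analysis x).
Proof.
have H1 := cvg_Re_herm hh (x := x) (synthesis_cvg (analysis_ell2 x)).
have H2 := sqsum_cvg (analysis_ell2 x).
rewrite -(cvg_lim _ H1) // -(cvg_lim _ H2) //; congr (limn _); apply/funext => n.
rewrite /series /= (herm_sum hh) Re_sum; apply: eq_bigr => i _.
by rewrite (hermZ hh) (herm_conj hh (v i)) mulcJ.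
Qed.

Lemma frame_op_le x : rnorm (frame_op x) ^+ 2 <= B * sqsum (analysis x).
Proof. exact: synthesis_le (analysis_ell2 x). Qed.

(** Richardson iteration for [frame_op x = m], with residuals
    r_n = m - F u_n obeying r_(n+1) = r_n - F r_n / B.  Since h(F r, r) = s(r)
    and h(F r, F r) <= |F r|^2 <= B s(r), one step gives
    h(r', r') <= h(r, r) - s(r) / B <= (1 - alpha / B) h(r, r).
    Contraction takes place in the seminorm of [h] on [V] only, so it is in
    that seminorm that the residuals tend to 0. *)
Lemma neumann (V : set K) (alpha : R) m : is_subspace V -> 0 < alpha ->
  (forall x, V x -> V (frame_op x)) ->
  (forall x, V x -> 0 <= quad h x /\ alpha * quad h x <= sqsum (analysis x)) ->
  V m -> exists2 u, forall n, V (u n) &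
    (fun n => quad h (m - frame_op (u n))) @ \oo --> (0 : R).
Proof.
move=> sV a0 VF Vq Vm.
pose fix u n : K := if n is n'.+1 then (B^-1)%:C *: (m - frame_op (u n')) + u n' else 0.
have Vu n : V (u n).
  by elim: n => [|n IH] /=; [exact: sV.1|apply: sV.2 => //; apply: subspaceB => //; exact: VF].
exists u => //.
(* The maximum keeps the ratio nonnegative when alpha > B. *)
pose rho := Num.max 0 (1 - alpha / B).
have rho0 : 0 <= rho by rewrite /rho le_max lexx.
have rho1 : rho < 1.
  by rewrite /rho gt_max ltr01 /= ltrBlDr ltrDl divr_gt0.
have step r : V r -> quad h (r - frame_op ((B^-1)%:C *: r)) <= rho * quad h r.
  move=> Vr; have [q0 aq] := Vq _ Vr.
  have -> : r - frame_op ((B^-1)%:C *: r) = r + (- B^-1)%:C *: frame_op r.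
    by rewrite frame_opZ rmorphN /= scaleNr.
  rewrite (quadDZ hh) (herm_ReC hh) Re_frame_op.
  have h1 := le_trans (ler_norm _) (quad_le hh (frame_op r)).
  have h2 := le_trans h1 (frame_op_le r).
  have : rho * quad h r >= (1 - alpha / B) * quad h r.
    by rewrite ler_wpM2r // /rho le_max lexx orbT.
  apply: le_trans.
  have h3 : (- B^-1) ^+ 2 * quad h (frame_op r) <= B^-1 * sqsum (analysis r).
    rewrite sqrrN expr2 -mulrA ler_pM2l ?invr_gt0 //.
    by rewrite -(ler_pM2l B0) mulVKf ?gt_eqF.
  have h4 : alpha / B * quad h r <= B^-1 * sqsum (analysis r).
    by rewrite mulrAC mulrC ler_pM2l ?invr_gt0.
  lra.
have dec n : quad h (m - frame_op (u n)) <= rho ^+ n * quad h m.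
  elim: n => [|n IH]; first by rewrite frame_op0 subr0 mul1r.
  have -> : m - frame_op (u n.+1) =
      (m - frame_op (u n)) - frame_op ((B^-1)%:C *: (m - frame_op (u n))).
    by rewrite /= frame_op_linear frame_opZ opprD addrA addrAC.
  apply: le_trans (step _ _) _; first by apply: subspaceB => //; exact: VF.
  by rewrite exprS -mulrA ler_wpM2l.
have rho_cvg : (fun n => rho ^+ n) @ \oo --> (0 : R).
  by apply: cvg_expr; rewrite ger0_norm.
apply: (cvg_le_dist (C := quad h m) rho_cvg) => n.
rewrite subr0 mulrC ger0_norm //.
by have [] := Vq _ (subspaceB sV Vm (VF _ (Vu n))).
Qed.

End Analysis.
End Synthesis.

(** * Inverting the frame operator *)

Section Frames.
Context {R : realType} {K : completeNormedModType R[i]}.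
Implicit Types (x y : K) (u v : nat -> K) (M : set K) (h : K -> K -> R[i]).
Variables (g : K -> K -> R[i]) (hg : bounded_hermitian g).
Hypothesis gE : forall x, quad g x = rnorm x ^+ 2.
Variables (v : nat -> K) (B : R) (B0 : 0 < B) (vB : bessel_bound g v B).

Lemma quad_dist_le h (V : set K) m x y : bounded_hermitian h -> is_subspace V ->
  (forall z, V z -> 0 <= quad h z) -> V m -> V x -> V y ->
  quad h (x - y) <= 2 * quad h (m - x) + 2 * quad h (m - y).
Proof.
move=> hh sV qV Vm Vx Vy.
have -> : x - y = (m - y) - (m - x) by rewrite opprB addrCA [m - y - m]addrAC subrr add0r.
have := qV _ (subspaceD sV (subspaceB sV Vm Vy) (subspaceB sV Vm Vx)).
have := quadDZ hh (-1) (m - y) (m - x); rewrite rmorphN1 scaleN1r => ->.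
by rewrite (quadD hh); lra.
Qed.

(** The frame operator F satisfies alpha |x| <= |F x|, so the approximate
    solutions of F u = m given by [neumann] converge to a solution u, and
    c = (<u, v_n>)_n has |c|^2 = <F u, u> = <m, u> <= |m| |m| / alpha. *)
Theorem frame_reconstruction (alpha : R) m : 0 < alpha ->
  (forall x, alpha * rnorm x ^+ 2 <= sqsum (analysis v g x)) ->
  exists c, [/\ ell2 c, synthesis v c = m & sqsum c <= alpha^-1 * rnorm m ^+ 2].
Proof.
move=> a0 lowb; pose F := frame_op v g.
have sT : is_subspace [set: K] by [].
have q0 x : setT x -> 0 <= quad g x by rewrite gE sqr_ge0.
have gq x : setT x -> 0 <= quad g x /\ alpha * quad g x <= sqsum (analysis v g x).
  by move=> _; rewrite gE sqr_ge0.
have [u _ uF] := neumann hg gE B0 vB hg vB (V := setT) sT a0 (fun _ _ => I) gq (m := m) I.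
have Flow x : alpha * rnorm x <= rnorm (F x).
  have [->|x0] := eqVneq (rnorm x) 0; first by rewrite mulr0 rnorm_ge0.
  have xp : 0 < rnorm x by rewrite lt_def x0 rnorm_ge0.
  rewrite -(ler_pM2r xp) -mulrA -expr2; apply: le_trans (lowb x) _.
  rewrite -(Re_frame_op hg gE B0 vB hg vB).
  exact: le_trans (ler_norm _) (Re_herm_le hg _ _).
have Flow2 x : rnorm x ^+ 2 <= (alpha ^+ 2)^-1 * rnorm (F x) ^+ 2.
  rewrite -(ler_pM2l (exprn_gt0 2 a0)) mulVKf ?gt_eqF ?exprn_gt0 // -exprMn.
  by rewrite ler_sqr // nnegrE ?rnorm_ge0 // mulr_ge0 ?rnorm_ge0 // ltW.
have FB x y : F (x - y) = F x - F y := frame_opB hg gE B0 vB hg vB x y.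
have ul : cvgn u.
  apply: (@cauchy_sq_cvg _ _ _ (fun n => (alpha ^+ 2)^-1 * 2 * quad g (m - F (u n)))).
    by rewrite -(mulr0 ((alpha ^+ 2)^-1 * 2)); apply: cvgMr.
  move=> i j; apply: le_trans (Flow2 _) _; rewrite -!mulrA -mulrDr.
  by rewrite ler_pM2l ?invr_gt0 ?exprn_gt0 // FB -gE; exact: quad_dist_le sT q0 _ _ _.
set l := limn u in ul; have ul' := (cvg_rnorm _ _).1 ul.
have Fle x : rnorm (F x) <= B * rnorm x.
  have Bx : 0 <= B * rnorm x by rewrite mulr_ge0 ?rnorm_ge0 ?ltW.
  rewrite -ler_sqr ?nnegrE ?rnorm_ge0 //.
  apply: le_trans (frame_op_le hg gE B0 vB vB x) _.
  rewrite exprMn [B ^+ 2]expr2 -mulrA ler_pM2l //.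
  exact: (ell2_le (vB x)).2.
have Ful : F \o u @ \oo --> F l.
  apply/cvg_rnorm; apply: (cvg_le_dist (C := B) ul') => n.
  by rewrite subr0 ger0_norm ?rnorm_ge0 // -FB.
have Fum : F \o u @ \oo --> m.
  apply: cvg_rnorm_sq; rewrite (_ : (fun n => _) = (fun n => quad g (m - F (u n)))) //.
  by apply/funext => n; rewrite gE rnorm_distC.
have Flm : F l = m by exact: cvg_unique Ful Fum.
exists (analysis v g l); split => //; first exact: bessel_ell2 vB.
have h1 := Flow l; rewrite Flm in h1.
rewrite -(Re_frame_op hg gE B0 vB hg vB) -/(F l) Flm.
apply: le_trans (le_trans (ler_norm _) (Re_herm_le hg _ _)) _.
rewrite expr2 mulrCA ler_wpM2l ?rnorm_ge0 //.
by rewrite -(ler_pM2l a0) mulVKf ?gt_eqF.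
Qed.

(** On a nondegenerate subspace [h] could still induce a strictly weaker norm;
    the lower estimate with [alpha] excludes this.  On the range of
    the frame operator F the conclusion follows from
    h(F x - alpha x, F x - alpha x) >= 0.  Then the sequence F u_n that
    [neumann] attaches to m is Cauchy in norm, and its limit l satisfies
    h(m - l, m - l) = 0, so l = m. *)
Theorem uniform_definite h M (alpha : R) : bounded_hermitian h -> bessel_bound h v B ->
  is_subspace M -> closed M -> (forall n, M (v n)) -> 0 < alpha ->
  (forall x, M x -> 0 <= quad h x /\ alpha * quad h x <= sqsum (analysis v h x)) ->
  (forall x, M x -> (forall y, M y -> h x y = 0) -> x = 0) ->
  forall x, M x -> rnorm x ^+ 2 <= B / alpha * quad h x.
Proof.
move=> hh hB sM cM Mv a0 Mq nondeg m Mm.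
pose F := frame_op v h.
have MF x : M x -> M (F x).
  by move=> _; apply: (synthesis_closed hg gE B0 vB) => //; exact: bessel_ell2 hB.
have q0 x : M x -> 0 <= quad h x by move=> /Mq[].
have [u Mu uF] := neumann hg gE B0 vB hh hB sM a0 MF Mq Mm.
have rangeF x : M x -> rnorm (F x) ^+ 2 <= B / alpha * quad h (F x).
  move=> Mx; apply: le_trans (frame_op_le hg gE B0 vB hB x) _.
  rewrite -mulrA ler_pM2l // -(ler_pM2l a0) mulVKf ?gt_eqF //.
  have [_ low] := Mq _ Mx.
  have := q0 _ (subspaceD sM (MF _ Mx) (subspaceZ sM (- alpha)%:C Mx)).
  rewrite (quadDZ hh) (Re_frame_op hg gE B0 vB hh hB).
  by have := ler_wpM2l (ltW a0) low; lra.
have FB x y : F (x - y) = F x - F y := frame_opB hg gE B0 vB hh hB x y.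
have ul : cvgn (F \o u).
  apply: (@cauchy_sq_cvg _ _ _ (fun n => B / alpha * 2 * quad h (m - F (u n)))).
    by rewrite -(mulr0 (B / alpha * 2)); apply: cvgMr.
  move=> i j; rewrite /= -FB; apply: le_trans (rangeF _ (subspaceB sM (Mu _) (Mu _))) _.
  rewrite FB -[X in _ <= X + _]mulrA -[X in _ <= _ + X]mulrA -mulrDr.
  rewrite ler_pM2l ?divr_gt0 //.
  by apply: (quad_dist_le hh sM q0) => //; exact: MF.
set l := limn (F \o u) in ul.
have Ml : M l by apply: cvg_closed cM _ ul => n; exact: MF.
have lm : l = m.
  have qml : quad h (m - l) = 0.
    have H : (fun n => quad h (m - F (u n))) @ \oo --> quad h (m - l).
      by apply: (cvg_quad hh); apply: cvgB => //; exact: cvg_cst.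
    exact: cvg_unique H uF.
  apply/esym/eqP; rewrite -subr_eq0; apply/eqP; apply: nondeg; first exact: subspaceB.
  move=> y My; have := quad_cauchy_schwarz hh sM q0 (subspaceB sM Mm Ml) My.
  rewrite qml mul0r => h0; apply: ComplexField.Normc.eq0_normc.
  by apply/eqP; rewrite -sqrf_eq0 -/(normc2 _) eq_le h0 normc2_ge0.
rewrite lm in ul.
have H : (fun n => B / alpha * quad h (F (u n))) @ \oo --> B / alpha * quad h m.
  by apply: cvgMr; exact: cvg_quad ul.
rewrite -gE; apply: (ler_cvg_to (cvg_quad hg ul) H).
by apply: nearW => n; rewrite gE; apply: rangeF.
Qed.

Lemma Re_synthesis_le h c x (t : R) : bounded_hermitian h -> bessel_bound h v B ->
  ell2 c -> 0 < t ->
  2 * complex.Re (h (synthesis v c) x) <= t * sqsum c + t^-1 * sqsum (analysis v h x).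
Proof.
move=> hh hB cl t0.
have H : (fun n => 2 * complex.Re (h (series (fun n => c n *: v n) n) x)) @ \oo
    --> 2 * complex.Re (h (synthesis v c) x).
  by apply: cvgMr; apply: cvg_Re_herm => //; exact: (synthesis_cvg hg gE B0 vB cl).
apply: (cvgr_to_le H).
apply: nearW => n; rewrite /series /= (herm_sum hh) Re_sum mulr_sumr.
apply: (@le_trans _ _ (\sum_(0 <= i < n) (t * normc2 (c i) + t^-1 * normc2 (h x (v i))))).
  by apply: ler_sum => i _; rewrite (hermZ hh) (herm_conj hh x) normc2_conj Re_normc2.
rewrite big_split /= -!mulr_sumr lerD // ler_pM2l ?invr_gt0 //.
  exact: partial_le_sqsum.
exact: partial_le_sqsum (bessel_ell2 _ hB).
Qed.

End Frames.

(** * The forms of a Krein space *)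

Section KreinForms.
Context {R : realType} {K : completeNormedModType R[i]}.
Variable S : krein_space K.
Implicit Types (x y : K) (M : set K).

Local Notation J := (ksym S).

Lemma kform_herm : hermitian_form (kform S).
Proof.
split=> [a x y z|x y]; first by rewrite linearDl linearZl_LR.
by have := hermC (kform S) x y; rewrite expr0 mul1r.
Qed.

Lemma kneg_kpos_ortho p m : kpos S p -> kneg S m -> kform S m p = 0.
Proof. by move=> pp mm; rewrite (herm_conj kform_herm) kpos_kneg_ortho // rmorph0. Qed.

Lemma knegN m : kneg S m -> kneg S (- m).
Proof. by move=> mm; rewrite -scaleN1r; apply: subspaceZ (kneg_subspace S) _ _ mm. Qed.

Lemma ksymK x : J (J x) = x.
Proof.
have [p [m [pp mm ->]]] := kpos_kneg_decomp S x.
by rewrite ksymE // ksymE ?opprK //; exact: knegN.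
Qed.

Lemma kform_ksym x y : kform S (J x) y = kform S x (J y).
Proof.
have [p [m [pp mm ->]]] := kpos_kneg_decomp S x.
have [q [n [qq nn ->]]] := kpos_kneg_decomp S y.
rewrite !ksymE // !(hermD kform_herm) !(hermDr kform_herm) !(hermN kform_herm).
rewrite !(hermNr kform_herm).
rewrite (kpos_kneg_ortho pp nn) (kneg_kpos_ortho qq mm).
by rewrite !oppr0 !addr0 !add0r.
Qed.

Lemma jform_quad x : quad (jform S) x = rnorm x ^+ 2.
Proof.
by rewrite /quad /jform -krein_norm rnormE -rmorphXn.
Qed.

Lemma jnorm2E x : jnorm2 S x = rnorm x ^+ 2.
Proof. exact: jform_quad. Qed.

Lemma rnorm_ksym x : rnorm (J x) = rnorm x.
Proof.
apply/eqP; rewrite -(eqrXn2 (n := 2)) ?rnorm_ge0 // -!jform_quad /quad /jform.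
by rewrite ksymK kform_ksym.
Qed.

(** The bound is the Cauchy-Schwarz inequality of the inner product itself. *)
Lemma jform_hermitian : bounded_hermitian (jform S).
Proof.
have jh : hermitian_form (jform S).
  split=> [a x y z|x y]; first exact: (herm_linear kform_herm).
  by rewrite /jform -kform_ksym (herm_conj kform_herm).
split => // x y; rewrite exprMn -!jform_quad.
have sT : is_subspace [set: K] by [].
by apply: (quad_cauchy_schwarz jh sT) => // z _; rewrite jform_quad sqr_ge0.
Qed.

(** [x, y] = <x, J y>, and J is an isometry. *)
Lemma kform_hermitian : bounded_hermitian (kform S).
Proof.
split; first exact: kform_herm.
by move=> x y; have := herm_bounded jform_hermitian x (J y); rewrite /jform ksymK rnorm_ksym.
Qed.

Lemma oppr_hermitian (h : K -> K -> R[i]) : bounded_hermitian h ->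
  bounded_hermitian (fun x y => - h x y).
Proof.
move=> hh; split.
  split=> [a x y z|x y]; first by rewrite (herm_linear hh) opprD mulrN.
  by rewrite (herm_conj hh) rmorphN.
move=> x y; rewrite /normc2 normcN; exact: (herm_bounded hh).
Qed.

End KreinForms.

(** * Closed spans and subfamilies of a frame *)

Section Closure.
Context {R : realType} {K : completeNormedModType R[i]}.
Implicit Types (x y : K) (A M N : set K) (h : K -> K -> R[i]).

Lemma closure_seq A x : closure A x ->
  exists2 u : nat -> K, forall n, A (u n) & u @ \oo --> x.
Proof.
move=> /closure_rnorm Ax.
have /choice [u uA] n : exists y, A y /\ rnorm (x - y) < n.+1%:R^-1.
  by have [|y Ay xy] := Ax n.+1%:R^-1; [rewrite invr_gt0|exists y].
exists u; first by move=> n; exact: (uA n).1.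
apply/cvg_rnorm; apply: (cvg_le_dist (C := 1) (@cvg_harmonic R)) => n.
rewrite subr0 mul1r ger0_norm ?rnorm_ge0 // rnorm_distC ltW //; exact: (uA n).2.
Qed.

Lemma closure_subspace M : is_subspace M -> is_subspace (closure M).
Proof.
move=> sM; split; first by apply: subset_closure; exact: sM.1.
move=> a x y /closure_seq[u Mu ux] /closure_seq[v Mv vy].
apply: (cvg_closed (u := fun n => a *: u n + v n) (@closed_closure _ M)).
  by move=> n; apply: subset_closure; exact: sM.2.
by apply: cvgD => //; exact: cvgZr.
Qed.

Lemma smallest_subspace A : is_subspace (smallest is_subspace A).
Proof.
split=> [M [sM _]|a x y Ax Ay M sAM]; first exact: sM.1.
by apply: sAM.1.2; [exact: Ax|exact: Ay].
Qed.

Lemma closed_span_subspace A : is_subspace (closed_span A).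
Proof. exact/closure_subspace/smallest_subspace. Qed.

Lemma closed_span_closed A : closed (closed_span A).
Proof. exact: closed_closure. Qed.

Lemma closed_span_sub A : A `<=` closed_span A.
Proof. by move=> x Ax; apply: subset_closure => M [_]; apply. Qed.

(** For h = [., .] and c > 0 this is uniform J-positivity, for h = - [., .]
    uniform J-negativity. *)
Definition coercive h (c : R) M := forall x, M x -> c * rnorm x ^+ 2 <= quad h x.

End Closure.

Section Subfamily.
Context {R : realType} {K : completeNormedModType R[i]}.
Implicit Types (x y : K) (w : nat -> K) (I : set nat) (N : set K) (h : K -> K -> R[i]).

(** Members outside [I] are replaced by 0, so that a part of a frame is again a
    sequence indexed by [nat] and the theory of Bessel sequences applies. *)
Definition subfamily I w n : K := if n \in I then w n else 0.

Lemma analysis_subfamily h I w x : hermitian_form h ->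
  analysis (subfamily I w) h x = coord_proj I (analysis w h x).
Proof.
move=> hh; apply/funext => n; rewrite /analysis /subfamily /coord_proj.
by case: ifP => // _; rewrite (herm_conj hh) herm0 // rmorph0.
Qed.

Lemma bessel_subfamily h I w B : hermitian_form h -> bessel_bound h w B ->
  bessel_bound h (subfamily I w) B.
Proof.
move=> hh hB k; apply: le_trans (hB k); apply: le_esum => n _; rewrite lee_fin.
rewrite -/(analysis _ h k n) analysis_subfamily // /coord_proj; case: ifP => // _.
by rewrite /normc2 ComplexField.Normc.normc0 expr0n sqr_ge0.
Qed.

Lemma synthesis_subfamily I w c :
  synthesis w (coord_proj I c) = synthesis (subfamily I w) c.
Proof.
congr (limn (series _)); apply/funext => n; rewrite /coord_proj /subfamily.
by case: ifP => // _; rewrite scale0r scaler0.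
Qed.

(** [w n] is the synthesis of a standard unit vector. *)
Lemma synthesis_range_mem I w n : I n -> synthesis_range w I (w n).
Proof.
move=> In; pose c i : R[i] := (i == n)%:R.
have partial m : (n < m)%N -> forall (V : nmodType) (F : nat -> V),
    (forall i, i != n -> F i = 0) -> \sum_(0 <= i < m) F i = F n.
  move=> nm V F F0; rewrite (bigD1_seq n) ?mem_index_iota ?iota_uniq //=.
  by rewrite big1 ?addr0.
exists c.
  apply: (@le_lt_trans _ _ 1%:E); last by rewrite ltry.
  rewrite -nneseries_esumT; last by move=> i; rewrite lee_fin normc2_ge0.
  apply: lime_le; first by apply: is_cvg_nneseries => i _ _; rewrite lee_fin normc2_ge0.
  exists n.+1 => // m /= nm; rewrite sumEFin partial //.
    by rewrite /c eqxx /normc2 ComplexField.Normc.normc1 expr1n.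
  by move=> i /negPf; rewrite /c => ->; rewrite /normc2 ComplexField.Normc.normc0 expr0n.
apply: synthesis_unique; apply: cvg_near_cst; exists n.+1 => // m /= nm.
rewrite /series /= partial //; first by rewrite /coord_proj mem_set // /c eqxx scale1r.
by move=> i /negPf ni; rewrite /coord_proj /c ni; case: ifP; rewrite scale0r.
Qed.

Variables (g : K -> K -> R[i]) (hg : bounded_hermitian g).
Hypothesis gE : forall x, quad g x = rnorm x ^+ 2.
Variables (w : nat -> K) (B : R) (B0 : 0 < B) (wB : bessel_bound g w B).

Lemma coercive_closure h c M : bounded_hermitian h ->
  coercive h c M -> coercive h c (closure M).
Proof.
move=> hh cM x /closure_seq[u Mu ux].
have H : (fun n => c * quad g (u n)) @ \oo --> c * quad g x.
  by apply: cvgMr; exact: cvg_quad ux.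
rewrite -gE; apply: (ler_cvg_to H (cvg_quad hh ux)).
by apply: nearW => n; rewrite gE; exact: cM.
Qed.

Lemma coercive_closed_span h c I : bounded_hermitian h ->
  is_subspace (synthesis_range w I) -> coercive h c (synthesis_range w I) ->
  coercive h c (closed_span (w @` I)).
Proof.
move=> hh sR cR; have := coercive_closure hh cR.
move=> cl x xM; apply: cl; move: x xM; apply: closure_subset.
by apply: smallest_sub => // _ [n In <-]; exact: synthesis_range_mem.
Qed.

Lemma synthesis_in_span I c : ell2 c ->
  closed_span (w @` I) (synthesis (subfamily I w) c).
Proof.
have sM := @closed_span_subspace R K (w @` I).
apply: (synthesis_closed hg gE B0 (bessel_subfamily _ hg wB)) => //.
  exact: closed_span_closed.
move=> n; rewrite /subfamily; case: ifP => [|_]; last exact: sM.1.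
by rewrite inE => In; apply: closed_span_sub; exists n.
Qed.

Variables (alpha : R) (a0 : 0 < alpha).
Hypothesis low : forall x, alpha * rnorm x ^+ 2 <= sqsum (analysis w g x).

(** Expand x along the whole frame.  The component along the complementary
    family is the difference of x and a vector of [N], hence lies in [N], where
    h is at least c0 |.|^2; but h is nonpositive on it, so it is 0. *)
Lemma coercive_expansion h (c0 : R) I N : 0 < c0 -> is_subspace N -> coercive h c0 N ->
  (forall c, ell2 c -> N (synthesis (subfamily I w) c)) ->
  (forall c, ell2 c -> quad h (synthesis (subfamily (~` I) w) c) <= 0) ->
  forall x, N x -> exists c, [/\ ell2 c, synthesis (subfamily I w) c = x &
    sqsum c <= alpha^-1 * rnorm x ^+ 2].
Proof.
move=> c00 sN cN NI hI x Nx.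
have [c [cl cE cx]] := frame_reconstruction hg gE B0 wB x a0 low.
exists c; split => //.
have split : synthesis w c = synthesis (subfamily I w) c + synthesis (subfamily (~` I) w) c.
  apply: synthesis_unique.
  rewrite (_ : series _ = (fun n => series (fun n => c n *: subfamily I w n) n
    + series (fun n => c n *: subfamily (~` I) w n) n)).
    by apply: cvgD; apply: (synthesis_cvg hg gE B0 (bessel_subfamily _ hg wB)).
  apply/funext => n; rewrite /series /= -big_split; apply: eq_bigr => i _ /=.
  rewrite /subfamily in_setC; by case: (i \in I); rewrite scaler0 ?addr0 ?add0r.
have Ny : N (synthesis (subfamily (~` I) w) c).
  rewrite (_ : synthesis _ _ = x - synthesis (subfamily I w) c).
    by apply: subspaceB => //; exact: NI.
  by rewrite -cE split addrAC subrr add0r.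
have y0 : synthesis (subfamily (~` I) w) c = 0.
  have := le_trans (cN _ Ny) (hI c cl); rewrite pmulr_rle0 // => y2.
  by apply: rnorm0_eq0; apply/eqP; rewrite -sqrf_eq0 eq_le y2 sqr_ge0.
by rewrite -cE split y0 addr0.
Qed.

(** For x = sum of c_n w_n, h(x, x) is the sum of the c_n h(w_n, x); the weight
    alpha * c0 makes the part of [Re_normc2] in c at most h(x, x), which is
    absorbed on the left. *)
Lemma coercive_analysis_ge h (c0 : R) I N : bounded_hermitian h -> bessel_bound h w B ->
  0 < c0 -> coercive h c0 N ->
  (forall x, N x -> exists c, [/\ ell2 c, synthesis (subfamily I w) c = x &
    sqsum c <= alpha^-1 * rnorm x ^+ 2]) ->
  forall x, N x -> alpha * c0 * quad h x <= sqsum (analysis (subfamily I w) h x).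
Proof.
move=> hh hB c00 cN expN x Nx; have [c [cl cx sc]] := expN x Nx.
have t0 : 0 < alpha * c0 by rewrite mulr_gt0.
have := Re_synthesis_le hg gE B0 (bessel_subfamily I hg wB) x hh
  (bessel_subfamily I hh hB) cl t0.
rewrite cx -/(quad h x).
have h1 : alpha * c0 * sqsum c <= quad h x.
  apply: le_trans (cN x Nx); rewrite mulrAC mulrC ler_pM2l //.
  by rewrite -(ler_pM2l (x := alpha^-1)) ?invr_gt0 // mulKf ?gt_eqF.
move=> h2; rewrite -(ler_pM2l (x := (alpha * c0)^-1)) ?invr_gt0 // mulKf ?gt_eqF //.
lra.
Qed.

End Subfamily.

(** * Frames that are J-frames *)

Section SingleFrame.
Context {R : realType} {K : completeNormedModType R[i]}.
Variable S : krein_space K.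
Variables (w : nat -> K) (alpha B : R) (a0 : 0 < alpha) (B0 : 0 < B).
Hypothesis frame_low : forall k, ((alpha * jnorm2 S k)%:E <= frame_sum S w setT k)%E.
Hypothesis frame_upp : forall k, (frame_sum S w setT k <= (B * jnorm2 S k)%:E)%E.
Implicit Types (x y k : K) (I : set nat) (M N : set K) (h : K -> K -> R[i]).

Local Notation g := (jform S).
Local Notation span I := (closed_span (w @` I)).
Let hg := jform_hermitian S.
Let gE := jform_quad S.

Lemma kform_bessel : bessel_bound (kform S) w B.
Proof. by move=> k; rewrite -(jnorm2E S); exact: frame_upp. Qed.

Lemma analysis_jform x : analysis w g x = analysis w (kform S) (ksym S x).
Proof. by apply/funext => n; rewrite /analysis /jform kform_ksym. Qed.

Lemma jform_bessel : bessel_bound g w B.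
Proof.
move=> k; rewrite -(rnorm_ksym S) -/(analysis w g k _).
by under eq_esum do rewrite -/(analysis w g k _) analysis_jform; exact: kform_bessel.
Qed.

Lemma jform_low x : alpha * rnorm x ^+ 2 <= sqsum (analysis w g x).
Proof.
rewrite analysis_jform -(rnorm_ksym S) -lee_fin -sqsumE; last exact: bessel_ell2 kform_bessel.
by rewrite -(jnorm2E S); exact: frame_low.
Qed.

Lemma frame_sumE I k :
  frame_sum S w I k = (sqsum (analysis (subfamily I w) (kform S) k))%:E.
Proof.
rewrite -sqsumE; last first.
  exact: bessel_ell2 (bessel_subfamily I (kform_herm S) kform_bessel).
rewrite /frame_sum esum_mkcond; apply: eq_esum => n _.
rewrite analysis_subfamily; last exact: kform_herm.
rewrite /coord_proj; case: ifP => // _.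
by rewrite /normc2 ComplexField.Normc.normc0 expr0n.
Qed.

Lemma synthesis_rangeE I :
  synthesis_range w I = [set synthesis (subfamily I w) c | c in @ell2 R].
Proof. by apply: eq_imagel => c _; exact: synthesis_subfamily. Qed.

(** One sign of the implication from J-frames to two-sided estimates; it is used
    for h = [., .] and for h = - [., .]. *)
Lemma span_bounds h I (c0 : R) : bounded_hermitian h -> bessel_bound h w B ->
  0 < c0 -> is_subspace (synthesis_range w I) -> coercive h c0 (synthesis_range w I) ->
  (forall x, synthesis_range w (~` I) x -> quad h x <= 0) ->
  coercive h c0 (span I) /\ exists a b, [/\ 0 < a, a <= b & forall k, span I k ->
    a * quad h k <= sqsum (analysis (subfamily I w) h k) /\
    sqsum (analysis (subfamily I w) h k) <= b * quad h k].
Proof.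
move=> hh hB c00 sR cR negR.
have cM := coercive_closed_span hg gE hh sR cR.
split => //.
(* The maximum only serves to order the two constants. *)
exists (alpha * c0), (Num.max (alpha * c0) (B / c0)); split.
- by rewrite mulr_gt0.
- by rewrite le_max lexx.
move=> k Mk; split.
  apply: (coercive_analysis_ge hg gE B0 jform_bessel a0 hh hB c00 cM) => //.
  apply: (coercive_expansion hg gE B0 jform_bessel a0 jform_low c00 _ cM).
  - exact: closed_span_subspace.
  - by move=> c cl; exact: (synthesis_in_span hg gE B0 jform_bessel).
  - by move=> c cl; apply: negR; rewrite synthesis_rangeE; exists c.
have q0 : 0 <= quad h k.
  by apply: le_trans (cM _ Mk); rewrite mulr_ge0 ?sqr_ge0 // ltW.
apply: le_trans (ell2_le (bessel_subfamily I hh hB k)).2 _.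
apply: (@le_trans _ _ (B / c0 * quad h k)).
  rewrite -mulrA ler_pM2l // -(ler_pM2l c00) mulVKf ?gt_eqF //; exact: cM.
by rewrite ler_wpM2r // le_max lexx orbT.
Qed.

(** [coercive_expansion] for N = the span itself identifies the range of the
    synthesis operator; for larger N it gives maximality. *)
Lemma span_range h I (c0 : R) : bounded_hermitian h -> 0 < c0 -> coercive h c0 (span I) ->
  (forall x, span (~` I) x -> quad h x <= 0) ->
  synthesis_range w I = span I /\ forall N c, 0 < c -> is_subspace N -> coercive h c N ->
    span I `<=` N -> N = span I.
Proof.
move=> hh c00 cM negM.
have inM J c : ell2 c -> span J (synthesis (subfamily J w) c).
  exact: (synthesis_in_span hg gE B0 jform_bessel).
have expN N c : 0 < c -> is_subspace N -> coercive h c N -> span I `<=` N ->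
    N `<=` synthesis_range w I.
  move=> cp sN cN MN x Nx; rewrite synthesis_rangeE.
  have inN d : ell2 d -> N (synthesis (subfamily I w) d) by move=> /(inM I)/MN.
  have outN d : ell2 d -> quad h (synthesis (subfamily (~` I) w) d) <= 0.
    by move=> /(inM (~` I)); exact: negM.
  have [d [dl <- _]] := coercive_expansion hg gE B0 jform_bessel a0 jform_low
    cp sN cN inN outN Nx.
  by exists d.
have RM : synthesis_range w I `<=` span I.
  by rewrite synthesis_rangeE => _ [c cl <-]; exact: inM.
split.
  by apply/seteqP; split => //; apply: expN c00 _ cM _ => //; exact: closed_span_subspace.
move=> N c cp sN cN MN; apply/seteqP; split => // x Nx.
by apply: RM; exact: expN cp sN cN MN _ Nx.
Qed.

(** Positivity of h comes from the upper estimate, whose left side is a sum of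
    squares. *)
Lemma span_coercive h I (a b : R) : bounded_hermitian h -> bessel_bound h w B ->
  0 < a -> 0 < b ->
  (forall k, span I k -> a * quad h k <= sqsum (analysis (subfamily I w) h k) /\
    sqsum (analysis (subfamily I w) h k) <= b * quad h k) ->
  (forall x, span I x -> (forall y, span I y -> h x y = 0) -> x = 0) ->
  (forall x, span I x -> 0 <= quad h x) /\ coercive h (a / B) (span I).
Proof.
move=> hh hB a1 b1 ab nondeg.
have q0 x : span I x -> 0 <= quad h x.
  move=> Mx; have := le_trans (sqsum_ge0 _) (ab _ Mx).2.
  by rewrite pmulr_rge0.
split => // x Mx.
have Mq y : span I y -> 0 <= quad h y /\
    a * quad h y <= sqsum (analysis (subfamily I w) h y).
  by move=> My; split; [exact: q0|exact: (ab _ My).1].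
have Mv n : span I (subfamily I w n).
  rewrite /subfamily; case: ifP => [|_]; last exact: (closed_span_subspace _).1.
  by rewrite inE => In; apply: closed_span_sub; exists n.
have := uniform_definite hg gE B0 (bessel_subfamily I hg jform_bessel) hh
  (bessel_subfamily I hh hB) (closed_span_subspace (w @` I)) (@closed_span_closed _ _ _)
  Mv a1 Mq nondeg Mx.
move=> H; rewrite [leRHS](_ : _ = a / B * (B / a * quad h x)).
  by rewrite ler_pM2l ?divr_gt0.
by field; rewrite !gt_eqF.
Qed.

Local Notation P := (pos_idx S w setT).
Local Notation N := (neg_idx S w setT).
Local Notation nform := (fun x y => - kform S x y).

Lemma setC_pos_idx : ~` P = N.
Proof.
apply/seteqP; split => n /=.
  by move=> nP; split=> //; rewrite ltNge; apply/negP => n0; apply: nP.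
by move=> [_ n0] [_]; rewrite leNgt n0.
Qed.

Lemma setC_neg_idx : ~` N = P.
Proof. by rewrite -setC_pos_idx setCK. Qed.

Lemma quad_nform x : quad nform x = - qform S x.
Proof. by rewrite /quad /qform; case: (kform S x x). Qed.

Lemma nform_hermitian : bounded_hermitian nform.
Proof. exact: oppr_hermitian (kform_hermitian S). Qed.

Lemma nform_bessel : bessel_bound nform w B.
Proof.
move=> k; apply: le_trans (kform_bessel k); apply: le_esum => n _.
by rewrite lee_fin /normc2 normcN.
Qed.

Lemma sqsum_nform v k : sqsum (analysis v nform k) = sqsum (analysis v (kform S) k).
Proof.
by congr fine; apply: eq_esum => n _; rewrite /analysis /normc2 normcN.
Qed.

Lemma coercive_nondegenerate h (c : R) M : is_subspace M -> 0 < c -> coercive h c M ->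
  (forall x, kform S x x = 0 -> quad h x = 0) -> J_nondegenerate S M.
Proof.
move=> sM c0 cM kh; apply/seteqP; split => x /=; last first.
  by move=> ->; split; [exact: sM.1|move=> y _; rewrite (herm0 (kform_herm S))].
move=> [Mx ortho]; have := cM x Mx; rewrite kh; last exact: ortho.
rewrite pmulr_rle0 // => x2; apply: rnorm0_eq0; apply/eqP.
by rewrite -sqrf_eq0 eq_le x2 sqr_ge0.
Qed.

Lemma uniformly_J_positiveE M : uniformly_J_positive S M <->
  is_subspace M /\ exists2 c : R, 0 < c & coercive (kform S) c M.
Proof.
by split=> -[sM [c c0 cM]]; split=> //; exists c => // x Mx;
  have := cM x Mx; rewrite (jnorm2E S).
Qed.

Lemma uniformly_J_negativeE M : uniformly_J_negative S M <->
  is_subspace M /\ exists2 c : R, 0 < c & coercive nform c M.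
Proof.
by split=> -[sM [c c0 cM]]; split=> //; exists c => // x Mx;
  have := cM x Mx; rewrite (jnorm2E S) quad_nform.
Qed.

(** Both signs are obtained from the lemmas above; the complementary family of
    the positive indices is that of the negative ones, so the nonpositivity
    hypothesis for one sign is the positivity established for the other. *)
Theorem J_frameP : is_J_frame S w <->
  (J_nondegenerate S (span P) /\ J_nondegenerate S (span N)) /\
  exists alpham betam alphap betap : R,
    [/\ betam <= alpham, alpham < 0, 0 < alphap, alphap <= betap &
     (forall k, span P k ->
        ((alphap * qform S k)%:E <= frame_sum S w P k)%E /\
        (frame_sum S w P k <= (betap * qform S k)%:E)%E) /\
     (forall k, span N k ->
        ((alpham * qform S k)%:E <= frame_sum S w N k)%E /\
        (frame_sum S w N k <= (betam * qform S k)%:E)%E)].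
Proof.
have hk := kform_hermitian S; have hn := nform_hermitian.
split.
- move=> [_ [/uniformly_J_positiveE[sP [cp cp0 cP]] _]].
  move=> [/uniformly_J_negativeE[sN [cn cn0 cN]] _].
  have negP x : synthesis_range w (~` P) x -> quad (kform S) x <= 0.
    rewrite setC_pos_idx => /cN; rewrite quad_nform => cNx.
    by rewrite -oppr_ge0; apply: le_trans cNx; rewrite mulr_ge0 ?sqr_ge0 // ltW.
  have negN x : synthesis_range w (~` N) x -> quad nform x <= 0.
    rewrite setC_neg_idx quad_nform => /cP cPx.
    by rewrite oppr_le0; apply: le_trans cPx; rewrite mulr_ge0 ?sqr_ge0 // ltW.
  have [cMP [ap [bp [ap0 apbp hP]]]] := span_bounds hk kform_bessel cp0 sP cP negP.
  have [cMN [am [bm [am0 ambm hN]]]] := span_bounds hn nform_bessel cn0 sN cN negN.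
  split.
    split.
      apply: (coercive_nondegenerate (closed_span_subspace _) cp0 cMP) => x x0.
      by rewrite /quad x0.
    apply: (coercive_nondegenerate (closed_span_subspace _) cn0 cMN) => x x0.
    by rewrite /quad x0 oppr0.
  exists (- am), (- bm), ap, bp; split => //; rewrite ?lerN2 ?oppr_lt0 //.
  split=> k Mk; rewrite frame_sumE !lee_fin; first exact: hP.
  by have := hN k Mk; rewrite quad_nform sqsum_nform !mulrN !mulNr.
- move=> [[ndP ndN] [am [bm [ap [bp [bmam am0 ap0 apbp [hP hN]]]]]]].
  have ndh h M : (forall x y, h x y = 0 -> kform S x y = 0) -> J_nondegenerate S M ->
      forall x, M x -> (forall y, M y -> h x y = 0) -> x = 0.
    move=> hkf nd x Mx ox; have : (M `&` ortho_companion S M) x.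
      by split => // y My; apply: hkf; exact: ox.
    by rewrite nd.
  have hP' k : span P k ->
      ap * quad (kform S) k <= sqsum (analysis (subfamily P w) (kform S) k) /\
      sqsum (analysis (subfamily P w) (kform S) k) <= bp * quad (kform S) k.
    by move=> Mk; have := hP k Mk; rewrite frame_sumE !lee_fin.
  have hN' k : span N k ->
      - am * quad nform k <= sqsum (analysis (subfamily N w) nform k) /\
      sqsum (analysis (subfamily N w) nform k) <= - bm * quad nform k.
    by move=> Mk; have := hN k Mk; rewrite frame_sumE !lee_fin quad_nform sqsum_nform !mulrNN.
  have [qP cP] := span_coercive hk kform_bessel ap0 (lt_le_trans ap0 apbp) hP'
    (ndh _ _ (fun _ _ => id) ndP).
  have nam0 : 0 < - am by rewrite oppr_gt0.
  have nbm0 : 0 < - bm by rewrite oppr_gt0 (le_lt_trans bmam).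
  have nk0 x y : nform x y = 0 -> kform S x y = 0.
    by move=> /eqP; rewrite oppr_eq0 => /eqP.
  have [qN cN] := span_coercive hn nform_bessel nam0 nbm0 hN' (ndh _ _ nk0 ndN).
  have cp0 : 0 < ap / B by rewrite divr_gt0.
  have cn0 : 0 < - am / B by rewrite divr_gt0.
  have negP x : span (~` P) x -> quad (kform S) x <= 0.
    by rewrite setC_pos_idx => /qN; rewrite quad_nform oppr_ge0.
  have negN x : span (~` N) x -> quad nform x <= 0.
    by rewrite setC_neg_idx => /qP; rewrite quad_nform oppr_le0.
  have [RP maxP] := span_range hk cp0 cP negP.
  have [RN maxN] := span_range hn cn0 cN negN.
  split.
  + exists B => // k; rewrite (jnorm2E S); exact: jform_bessel.
  + rewrite RP; split.
      apply/uniformly_J_positiveE; split; first exact: closed_span_subspace.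
      by exists (ap / B).
    by move=> M /uniformly_J_positiveE[sM [c c0 cM]] MN; exact: maxP c0 sM cM MN.
  + rewrite RN; split.
      apply/uniformly_J_negativeE; split; first exact: closed_span_subspace.
      by exists (- am / B).
    by move=> M /uniformly_J_negativeE[sM [c c0 cM]] MN; exact: maxN c0 sM cM MN.
Qed.

End SingleFrame.

(** * Weaving *)

Section Weaving.
Context {R : realType} {K : completeNormedModType R[i]}.
Variable S : krein_space K.
Implicit Types (z : nat -> K) (sigma : set nat) (Q : set K).

Lemma weave_in z z' sigma n : sigma n -> weave z z' sigma n = z n.
Proof. by move=> sn; rewrite /weave mem_set. Qed.

Lemma weave_out z z' sigma n : ~ sigma n -> weave z z' sigma n = z' n.
Proof. by move=> sn; rewrite /weave memNset. Qed.

(** [Q] is the sign condition on [w_n, w_n], or [setT] for the whole frame. *)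
Lemma weave_preimage z z' sigma Q : [set n | setT n /\ Q (weave z z' sigma n)] =
  [set n | sigma n /\ Q (z n)] `|` [set n | (~` sigma) n /\ Q (z' n)].
Proof.
apply/seteqP; split=> n /=.
  by have [sn|sn] := pselect (sigma n); [rewrite weave_in // => -[]; left|
    rewrite weave_out // => -[]; right].
by move=> [[sn]|[sn]]; [rewrite weave_in|rewrite weave_out].
Qed.

Lemma weave_image z z' sigma Q :
  weave z z' sigma @` [set n | setT n /\ Q (weave z z' sigma n)] =
  z @` [set n | sigma n /\ Q (z n)] `|` z' @` [set n | (~` sigma) n /\ Q (z' n)].
Proof.
rewrite weave_preimage image_setU; congr (_ `|` _); apply: eq_imagel => n [sn _].
  exact: weave_in.
exact: weave_out.
Qed.

Lemma weave_frame_sum z z' sigma Q k :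
  frame_sum S (weave z z' sigma) [set n | setT n /\ Q (weave z z' sigma n)] k =
  (frame_sum S z [set n | sigma n /\ Q (z n)] k
   + frame_sum S z' [set n | (~` sigma) n /\ Q (z' n)] k)%E.
Proof.
rewrite {1}/frame_sum (esumID sigma) => [|n _]; last by rewrite lee_fin normc2_ge0.
rewrite weave_preimage; congr (_ + _)%E.
- rewrite (_ : _ `&` _ = [set n | sigma n /\ Q (z n)]).
    by apply: eq_esum => n [sn _]; rewrite weave_in.
  by apply/seteqP; split=> n /=; [case=> -[|[]]|move=> sz; split; [left|case: sz]].
- rewrite (_ : _ `&` _ = [set n | (~` sigma) n /\ Q (z' n)]).
    by apply: eq_esum => n [sn _]; rewrite weave_out.
  by apply/seteqP; split=> n /=; [case=> -[[]|]|move=> sz; split; [right|case: sz]].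
Qed.

Lemma weave_setT z z' : weave z z' setT = z.
Proof. by apply/funext => n; rewrite weave_in. Qed.

Lemma weave_set0 z z' : weave z z' set0 = z'.
Proof. by apply/funext => n; rewrite weave_out. Qed.

Lemma J_weaving_framesE z z' :
  J_weaving_frames S z z' <-> forall sigma, is_J_frame S (weave z z' sigma).
Proof.
split=> [[]//|h]; split => //.
  by rewrite -(weave_setT z z').
by rewrite -(weave_set0 z z').
Qed.

End Weaving.

Theorem theorem2p18 (R : realType) (K : completeNormedModType R[i])
    (S : krein_space K) (z z' : nat -> K) (hw : weaving_frames S z z') :
  J_weaving_frames S z z' <->
  ((forall sigma : set nat,
      J_nondegenerate S (M_pos S z z' sigma) /\
      J_nondegenerate S (M_neg S z z' sigma)) /\
   (forall sigma : set nat, exists alpham betam alphap betap : R,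
      [/\ betam <= alpham, alpham < 0, 0 < alphap, alphap <= betap &
       (forall k, M_pos S z z' sigma k ->
          ((alphap * qform S k)%:E
             <= frame_sum S z (pos_idx S z sigma) k
                + frame_sum S z' (pos_idx S z' (~` sigma)) k)%E /\
          (frame_sum S z (pos_idx S z sigma) k
             + frame_sum S z' (pos_idx S z' (~` sigma)) k
             <= (betap * qform S k)%:E)%E) /\
       (forall k, M_neg S z z' sigma k ->
          ((alpham * qform S k)%:E
             <= frame_sum S z (neg_idx S z sigma) k
                + frame_sum S z' (neg_idx S z' (~` sigma)) k)%E /\
          (frame_sum S z (neg_idx S z sigma) k
             + frame_sum S z' (neg_idx S z' (~` sigma)) k
             <= (betam * qform S k)%:E)%E)])).
Proof.
have [_ _ [alpha [B [a0 aB bounds]]]] := hw.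
have B0 : 0 < B by exact: lt_le_trans aB.
pose w sigma := weave z z' sigma.
have wT sigma k : frame_sum S (w sigma) setT k =
    (frame_sum S z sigma k + frame_sum S z' (~` sigma) k)%E.
  have := weave_frame_sum S z z' sigma setT k.
  have E A : [set n : nat | A n /\ True] = A.
    by apply/seteqP; split=> n /=; [case|split].
  by rewrite !E.
have low sigma k : ((alpha * jnorm2 S k)%:E <= frame_sum S (w sigma) setT k)%E.
  by rewrite wT; exact: (bounds sigma k).1.
have upp sigma k : (frame_sum S (w sigma) setT k <= (B * jnorm2 S k)%:E)%E.
  by rewrite wT; exact: (bounds sigma k).2.
have JP sigma := J_frameP a0 B0 (low sigma) (upp sigma).
have sp sigma : closed_span (w sigma @` pos_idx S (w sigma) setT) = M_pos S z z' sigma.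
  by rewrite /M_pos /pos_idx (weave_image z z' sigma [set x | 0 <= qform S x]).
have sn sigma : closed_span (w sigma @` neg_idx S (w sigma) setT) = M_neg S z z' sigma.
  by rewrite /M_neg /neg_idx (weave_image z z' sigma [set x | qform S x < 0]).
have fp sigma k : frame_sum S (w sigma) (pos_idx S (w sigma) setT) k =
    (frame_sum S z (pos_idx S z sigma) k + frame_sum S z' (pos_idx S z' (~` sigma)) k)%E.
  exact: (weave_frame_sum S z z' sigma [set x | 0 <= qform S x]).
have fn sigma k : frame_sum S (w sigma) (neg_idx S (w sigma) setT) k =
    (frame_sum S z (neg_idx S z sigma) k + frame_sum S z' (neg_idx S z' (~` sigma)) k)%E.
  exact: (weave_frame_sum S z z' sigma [set x | qform S x < 0]).
have {}JP sigma := JP sigma; rewrite J_weaving_framesE.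
split=> [Jw|[nd bd] sigma].
  split=> sigma; have := (JP sigma).1 (Jw sigma); rewrite sp sn => -[nd] //.
  move=> [am [bm [ap [bp [? ? ? ? [hP hN]]]]]].
  exists am, bm, ap, bp; split => //; split=> k; rewrite -?fp -?fn; [exact: hP|exact: hN].
apply/(JP sigma); rewrite sp sn; split; first exact: nd.
have [am [bm [ap [bp [? ? ? ? [hP hN]]]]]] := bd sigma.
by exists am, bm, ap, bp; split => //; split=> k; rewrite ?fp ?fn; [exact: hP|exact: hN].
Qed.
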